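(* Consider the deterministic GDA method with an arbitrary choice of learning rates $\eta_x,\eta_y>0$, and let $\bar x$ be the returned solution after $T$ iterations. For all $\ell\ge\mu>0$, with $\kappa=\ell/\mu$, and every $\Delta>0$ there is a constant $c>0$ depending only on $\ell$ and $\Delta$ (in particular not on the learning rates, $\kappa$ or $\epsilon$) such that for every choice of learning rates and all sufficiently small $\epsilon>0$ there exist an $\ell$-smooth function $f$ with $f(x,\cdot)$ $\mu$-strongly concave for every $x$, and an initialization $(x_0,y_0)$ with $\Phi(x_0)-\min_x\Phi(x)=\Delta$, such that $\|\nabla\Phi(\bar x)\|\le\epsilon$ implies $$T\ \ge\ c\,\frac{\kappa}{\epsilon^2}.$$ (That is, GDA requires at least $T=\Omega(\kappa/\epsilon^2)$ iterations to guarantee $\|\nabla\Phi(\bar x)\|\le\epsilon$.)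
   Context: $f$ is $\ell$-smooth if it is differentiable and $\|\nabla f(x_1,y_1)-\nabla f(x_2,y_2)\|^2\le \ell^2\|x_1-x_2\|^2+\ell^2\|y_1-y_2\|^2$. $\Phi(x)=\max_yf(x,y)$; the dual variable is unconstrained. GDA: $x_t=x_{t-1}-\eta_x\nabla_xf(x_{t-1},y_{t-1})$, $y_t=y_{t-1}+\eta_y\nabla_yf(x_{t-1},y_{t-1})$ for $t=1,\dots,T$; the returned $\bar x$ is chosen at random from $x_1,\dots,x_T$. The function $f$ may depend on the learning rates and on $\epsilon$. *)

(* Defs.v *)
From HB Require Import structures.
From mathcomp Require Import all_boot all_order all_algebra.
From mathcomp Require Import all_classical all_reals all_analysis.

Set Implicit Arguments.
Unset Strict Implicit.
Unset Printing Implicit Defensive.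

Import Order.TTheory GRing.Theory Num.Theory.
Import numFieldNormedType.Exports.

Local Open Scope ring_scope.

(* The library norm on 'rV[R]_d is the max norm, hence an explicit Euclidean
   norm here; differentiability does not depend on this choice. *)
Definition enorm (R : realType) (d : nat) (v : 'rV[R]_d) : R :=
  Num.sqrt (\sum_(i < d) v 0 i ^+ 2).

Definition grad (R : realType) (d : nat) (g : 'rV[R]_d -> R) (x : 'rV[R]_d) :
    'rV[R]_d :=
  \row_(i < d) derive g x (delta_mx 0 i).

Definition grad_x (R : realType) (m n : nat) (f : 'rV[R]_m -> 'rV[R]_n -> R)
    (x : 'rV[R]_m) (y : 'rV[R]_n) : 'rV[R]_m :=
  grad (fun u => f u y) x.

Definition grad_y (R : realType) (m n : nat) (f : 'rV[R]_m -> 'rV[R]_n -> R)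
    (x : 'rV[R]_m) (y : 'rV[R]_n) : 'rV[R]_n :=
  grad (f x) y.

(* The squared norm of a difference of full gradients is the sum of the squared
   norms of its x-block and of its y-block. *)
Definition smooth (R : realType) (m n : nat) (ell : R)
    (f : 'rV[R]_m -> 'rV[R]_n -> R) : Prop :=
  (forall z : 'rV[R]_m * 'rV[R]_n,
      differentiable (fun w : 'rV[R]_m * 'rV[R]_n => f w.1 w.2) z) /\
  (forall (x1 x2 : 'rV[R]_m) (y1 y2 : 'rV[R]_n),
      enorm (grad_x f x1 y1 - grad_x f x2 y2) ^+ 2
        + enorm (grad_y f x1 y1 - grad_y f x2 y2) ^+ 2
      <= ell ^+ 2 * enorm (x1 - x2) ^+ 2 + ell ^+ 2 * enorm (y1 - y2) ^+ 2).

Definition strongly_concave (R : realType) (d : nat) (mu : R)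
    (g : 'rV[R]_d -> R) : Prop :=
  forall (u v : 'rV[R]_d) (t : R), 0 <= t -> t <= 1 ->
    t * g u + (1 - t) * g v + mu / 2 * (t * (1 - t)) * enorm (u - v) ^+ 2
    <= g (t *: u + (1 - t) *: v).

(* Phi x = max_y f x y, the maximum being attained; this determines Phi. *)
Definition is_max_y (R : realType) (m n : nat)
    (f : 'rV[R]_m -> 'rV[R]_n -> R) (Phi : 'rV[R]_m -> R) : Prop :=
  forall x : 'rV[R]_m,
    (exists y : 'rV[R]_n, Phi x = f x y) /\
    (forall y : 'rV[R]_n, f x y <= Phi x).

Definition is_min (R : realType) (d : nat) (g : 'rV[R]_d -> R) (v : R) : Prop :=
  (exists x : 'rV[R]_d, v = g x) /\ (forall x : 'rV[R]_d, v <= g x).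

(* Both blocks are updated simultaneously, from the previous pair. *)
Definition gda_step (R : realType) (m n : nat)
    (f : 'rV[R]_m -> 'rV[R]_n -> R) (eta_x eta_y : R)
    (z : 'rV[R]_m * 'rV[R]_n) : 'rV[R]_m * 'rV[R]_n :=
  (z.1 - eta_x *: grad_x f z.1 z.2, z.2 + eta_y *: grad_y f z.1 z.2).

Definition gda (R : realType) (m n : nat)
    (f : 'rV[R]_m -> 'rV[R]_n -> R) (eta_x eta_y : R)
    (x0 : 'rV[R]_m) (y0 : 'rV[R]_n) (t : nat) : 'rV[R]_m * 'rV[R]_n :=
  iter t (gda_step f eta_x eta_y) (x0, y0).

(* Main.v *)
Require Import Defs.
From HB Require Import structures.
From mathcomp Require Import all_boot all_order all_algebra.
From mathcomp Require Import all_classical all_reals all_analysis.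
From mathcomp Require Import ring lra.

Import Order.TTheory GRing.Theory Num.Theory.
Import numFieldNormedType.Exports.

Local Open Scope ring_scope.

(* All instances are separable, f(x, y) = sum_i p(x_i) + b x_i y_i - mu/2 y_i^2,
   so Phi(x) = sum_i p(x_i) + b^2/(2 mu) x_i^2.
   If eta_x < 4 mu / ell^2, take b = 0 and p a Huber function of slope 2 eps: x has
   to travel a distance Delta/(2 eps) with steps at most 2 eps eta_x, which takes
   Delta/(4 eta_x eps^2) > (Delta ell/16) kappa/eps^2 iterations.
   If eta_x >= 4 mu / ell^2, GDA does not converge at all. For eta_x >= 2/ell
   the function p = ell/2 x^2 with b = 0 suffices. Otherwise take p = 0 and
   b^2 = mu / eta_x <= ell^2/4: the linear GDA map then has determinant 1 for every
   eta_y, hence a complex eigenvalue of modulus at least 1. Two coordinates, read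
   as one complex number and started on the eigenvector, keep |x_t| >= |x_0|,
   whereas a single coordinate could pass close to 0 while rotating. *)

(** * Gradients of coordinatewise sums and scalar derivatives *)

Lemma enorm_sq {R : realType} {d : nat} (v : 'rV[R]_d) :
  enorm v ^+ 2 = \sum_(i < d) v 0 i ^+ 2.
Proof. by rewrite /enorm sqr_sqrtr ?sumr_ge0// => i _; exact: sqr_ge0. Qed.

(** In the difference quotient along the [j]-th basis vector all other summands cancel exactly, so
    both sides are the limit of one and the same function. *)
Lemma grad_sum {R : realType} {d : nat} (g : 'I_d -> R -> R) (x : 'rV[R]_d) :
  grad (fun u => \sum_(i < d) g i (u 0 i)) x = \row_i ('D_1 (g i) (x 0 i)).
Proof.
apply/rowP => j; rewrite !mxE /derive.
apply: (congr1 (fun F : R -> R => lim (F h @[h --> 0^'])%classic)).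
apply/funext => h /=; congr (_ *: _).
rewrite -sumrB (bigD1 j)//= big1 ?addr0 => [|i /negbTE ij].
  by rewrite !mxE !eqxx.
by rewrite !mxE eqxx ij mulr0 add0r subrr.
Qed.

(** The quotient differs from [l] by at most [C * |h|]. This form treats the breakpoints of a
    piecewise quadratic like any other point. *)
Lemma is_derive_of_quadratic_remainder {R : realType} (g : R -> R) (x l C : R) :
  (forall h, `|g (x + h) - g x - l * h| <= C * h ^+ 2) -> is_derive x 1 g l.
Proof.
move=> gC.
have C0 : 0 <= C by have := le_trans (normr_ge0 _) (gC 1); rewrite expr1n mulr1.
have cvl : (h^-1 *: (g (h *: (1:R) + x) - g x) @[h --> 0^'] --> l)%classic.
  apply/cvgrPdist_le => e e0; near=> h.
  have h0 : h != 0 by near: h; exact: nbhs_dnbhs_neq.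
  have -> : l - h^-1 *: (g (h *: (1:R) + x) - g x) =
            - (h^-1 * (g (x + h) - g x - l * h)).
    rewrite scaler1 addrC [h + x]addrC.
    by change (h^-1 *: ?z) with (h^-1 * z); field.
  rewrite normrN normrM normfV ler_pdivrMl ?normr_gt0//.
  apply: (le_trans (gC h)).
  have -> : C * h ^+ 2 = `|h| * (C * `|h|).
    by rewrite [RHS]mulrCA -expr2 real_normK ?num_real.
  rewrite ler_wpM2l//.
  (* The [+ 1] keeps the denominator positive when [C = 0]. *)
  have : `|h| <= e / (C + 1).
    by near: h; apply: dnbhs0_le; rewrite divr_gt0 ?ltr_wpDl.
  rewrite ler_pdivlMr ?ltr_wpDl// => hle.
  have := normr_ge0 h; nra.
have dg : derivable g x 1 by apply/cvg_ex; exists l.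
by split => //; apply: cvg_lim.
Unshelve. all: by end_near. Qed.

Lemma differentiable_fst {R : realType} {V W : normedModType R}
  (z : (V * W)%type) : differentiable (fst : V * W -> V) z.
Proof. by apply: linear_differentiable => w; exact: cvg_fst. Qed.

Lemma differentiable_snd {R : realType} {V W : normedModType R}
  (z : (V * W)%type) : differentiable (snd : V * W -> W) z.
Proof. by apply: linear_differentiable => w; exact: cvg_snd. Qed.

(** * Separable functions, quadratic in the dual variable *)

Section Separable.
Context {R : realType} (d : nat) (p dp : R -> R) (C b mu : R).
Hypothesis dpP : forall x h, `|p (x + h) - p x - dp x * h| <= C * h ^+ 2.
Hypothesis mu_gt0 : 0 < mu.

Definition sep_f (x y : 'rV[R]_d) : R :=
  \sum_(i < d) (p (x 0 i) + b * x 0 i * y 0 i - mu / 2 * y 0 i ^+ 2).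

Definition sep_Phi (x : 'rV[R]_d) : R :=
  \sum_(i < d) (p (x 0 i) + b ^+ 2 / (2 * mu) * x 0 i ^+ 2).

Lemma grad_x_sep x y : grad_x sep_f x y = \row_i (dp (x 0 i) + b * y 0 i).
Proof.
rewrite /grad_x /sep_f.
rewrite (grad_sum (fun i t => p t + b * t * y 0 i - mu / 2 * y 0 i ^+ 2)).
apply/rowP => i; rewrite !mxE; apply: derive_val.
apply: (is_derive_of_quadratic_remainder _ _ _ C) => h.
by apply: le_trans (dpP (x 0 i) h); rewrite le_eqVlt; apply/orP; left;
  apply/eqP; congr (`|_|); ring.
Qed.

Lemma grad_y_sep x y : grad_y sep_f x y = \row_i (b * x 0 i - mu * y 0 i).
Proof.
rewrite /grad_y /sep_f.
rewrite (grad_sum (fun i t => p (x 0 i) + b * x 0 i * t - mu / 2 * t ^+ 2)).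
apply/rowP => i; rewrite !mxE; apply: derive_val.
apply: (is_derive_of_quadratic_remainder _ _ _ (mu / 2)) => h.
set z := (X in `|X|); have -> : z = - (mu / 2 * h ^+ 2) by rewrite /z; field.
by rewrite normrN ger0_norm// mulr_ge0 ?sqr_ge0// divr_ge0// ltW.
Qed.

Lemma grad_sep_Phi x :
  grad sep_Phi x = \row_i (dp (x 0 i) + b ^+ 2 / mu * x 0 i).
Proof.
rewrite /sep_Phi.
rewrite (grad_sum (fun i t => p t + b ^+ 2 / (2 * mu) * t ^+ 2)).
apply/rowP => i; rewrite !mxE; apply: derive_val.
apply: (is_derive_of_quadratic_remainder _ _ _ (C + b ^+ 2 / (2 * mu))) => h.
set z := (X in `|X|).
have -> : z = (p (x 0 i + h) - p (x 0 i) - dp (x 0 i) * h)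
            + b ^+ 2 / (2 * mu) * h ^+ 2.
  by rewrite /z; field; rewrite gt_eqF.
rewrite [leRHS]mulrDl; apply: le_trans (ler_normD _ _) _; apply: lerD => //.
by rewrite ger0_norm// mulr_ge0 ?sqr_ge0// divr_ge0 ?sqr_ge0// mulr_ge0// ltW.
Qed.

Lemma sep_differentiable (z : 'rV[R]_d * 'rV[R]_d) :
  differentiable (fun w : 'rV[R]_d * 'rV[R]_d => sep_f w.1 w.2) z.
Proof.
have coord1 i : differentiable (fun w : 'rV[R]_d * 'rV[R]_d => w.1 0 i) z.
  apply: (@differentiable_comp _ _ _ _ fst (fun x : 'rV[R]_d => x 0 i)).
    exact: differentiable_fst.
  exact: differentiable_coord.
have coord2 i : differentiable (fun w : 'rV[R]_d * 'rV[R]_d => w.2 0 i) z.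
  apply: (@differentiable_comp _ _ _ _ snd (fun x : 'rV[R]_d => x 0 i)).
    exact: differentiable_snd.
  exact: differentiable_coord.
have -> : (fun w : 'rV[R]_d * 'rV[R]_d => sep_f w.1 w.2) = \sum_(i < d)
    (fun w : 'rV[R]_d * 'rV[R]_d => p (w.1 0 i) + b * w.1 0 i * w.2 0 i
      - mu / 2 * w.2 0 i ^+ 2).
  by apply/funext => w; rewrite fct_sumE.
apply: differentiable_sum => i.
apply: differentiableB.
  apply: differentiableD.
    apply: (@differentiable_comp _ _ _ _ _ p) => //.
    apply/derivable1_diffP.
    have [] // := is_derive_of_quadratic_remainder _ _ _ _ (dpP (z.1 0 i)).
  apply: differentiableM => //; apply: differentiableM => //.
apply: differentiableM => //.
exact: (differentiableM (coord2 i) (coord2 i)).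
Qed.

(** Squared norms are sums over coordinates, so a scalar inequality for one coordinate pair
    suffices. *)
Lemma sep_smooth (ell : R) :
  (forall x1 x2 y1 y2 : R,
    (dp x1 - dp x2 + b * (y1 - y2)) ^+ 2
      + (b * (x1 - x2) - mu * (y1 - y2)) ^+ 2
    <= ell ^+ 2 * (x1 - x2) ^+ 2 + ell ^+ 2 * (y1 - y2) ^+ 2) ->
  smooth ell sep_f.
Proof.
move=> lip; split=> [|x1 x2 y1 y2]; first exact: sep_differentiable.
rewrite !grad_x_sep !grad_y_sep !enorm_sq !mulr_sumr -!big_split/=.
apply: ler_sum => i _; rewrite !mxE.
have := lip (x1 0 i) (x2 0 i) (y1 0 i) (y2 0 i).
congr (_ <= _); congr (_ ^+ 2 + _ ^+ 2); ring.
Qed.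

(** The curvature in [y] is exactly [mu], so equality holds in each coordinate. *)
Lemma sep_strongly_concave x : strongly_concave mu (sep_f x).
Proof.
move=> u v t _ _; rewrite enorm_sq /sep_f !mulr_sumr -!big_split/=.
by apply: ler_sum => i _; rewrite !mxE le_eqVlt; apply/orP; left;
  apply/eqP; field.
Qed.

(** The maximiser is the zero of the [y]-gradient; completing the square gives the gap for every
    other [y]. *)
Lemma sep_is_max : is_max_y sep_f sep_Phi.
Proof.
have mu0 : mu != 0 by rewrite gt_eqF.
move=> x; split.
  exists ((b / mu) *: x); apply: eq_bigr => i _; rewrite !mxE; by field.
move=> y; apply: ler_sum => i _; rewrite -subr_ge0.
have -> : p (x 0 i) + b ^+ 2 / (2 * mu) * x 0 i ^+ 2
    - (p (x 0 i) + b * x 0 i * y 0 i - mu / 2 * y 0 i ^+ 2)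
  = mu / 2 * (y 0 i - b / mu * x 0 i) ^+ 2 by field.
by rewrite mulr_ge0 ?sqr_ge0// divr_ge0// ltW.
Qed.

Lemma sep_is_min :
  p 0 = 0 -> (forall t, 0 <= p t + b ^+ 2 / (2 * mu) * t ^+ 2) ->
  is_min sep_Phi 0.
Proof.
move=> p0 Phi0; split; last by move=> x; exact: sumr_ge0.
by exists 0; rewrite /sep_Phi big1// => i _; rewrite !mxE p0 expr0n/= mulr0 addr0.
Qed.

Lemma gda_sepS (eta_x eta_y : R) x0 y0 t :
  let z := gda sep_f eta_x eta_y x0 y0 t in
  let z' := gda sep_f eta_x eta_y x0 y0 t.+1 in
  (forall i, z'.1 0 i = z.1 0 i - eta_x * (dp (z.1 0 i) + b * z.2 0 i)) /\
  (forall i, z'.2 0 i = z.2 0 i + eta_y * (b * z.1 0 i - mu * z.2 0 i)).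
Proof.
rewrite /gda /= {1 3}/gda_step /= grad_x_sep grad_y_sep.
by split=> i; rewrite !mxE.
Qed.

End Separable.

(** [B] is a free parameter: an instance whose gradients never fall to [eps] satisfies this for
    every [B]. *)
Definition hard_instance {R : realType} (ell mu Delta eta_x eta_y eps B : R) :=
  exists (m n : nat) (f : 'rV[R]_m -> 'rV[R]_n -> R) (Phi : 'rV[R]_m -> R)
         (x0 : 'rV[R]_m) (y0 : 'rV[R]_n),
    [/\ (0 < m)%N, (0 < n)%N, smooth ell f,
        (forall x : 'rV[R]_m, strongly_concave mu (f x)) & is_max_y f Phi] /\
    (exists Phi_min : R, is_min Phi Phi_min /\ Phi x0 - Phi_min = Delta) /\
    (forall t : nat,
       enorm (grad Phi (gda f eta_x eta_y x0 y0 t).1) <= eps -> B <= t%:R).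

(** * Truncation and the Huber function *)

Section Clamp.
Context {R : realType}.
Implicit Types r s t h : R.

Definition clamp r t : R := if t <= - r then - r else if t <= r then t else r.

(** A single formula for [t^2/2] on [[-r, r]] and [r|t| - r^2/2] outside; its derivative is
    [clamp r]. *)
Definition huber r t : R := t * clamp r t - clamp r t ^+ 2 / 2.

Lemma clampP r t : 0 <= r ->
  [\/ t <= - r /\ clamp r t = - r, - r < t <= r /\ clamp r t = t
    | r < t /\ clamp r t = r].
Proof.
rewrite /clamp => r0; case: (leP t (- r)) => ?; first by constructor 1.
by case: (leP t r) => ?; [constructor 2 | constructor 3].
Qed.

Lemma clamp0 r : 0 <= r -> clamp r 0 = 0.
Proof. by move=> r0; case: (clampP r 0 r0) => -[? ->]; lra. Qed.

Lemma clamp_le r t : 0 <= r -> clamp r t <= r.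
Proof. by move=> r0; case: (clampP r t r0) => -[? ->]; lra. Qed.

(** Turns a bound on the slope into a bound on the position: only the upper plateau lies below the
    identity. *)
Lemma clamp_lt r t : 0 <= r -> clamp r t < r -> t <= clamp r t.
Proof. by move=> r0; case: (clampP r t r0) => -[? ->]; lra. Qed.

Lemma clamp_increment r s t :
  0 <= r -> s <= t -> 0 <= clamp r t - clamp r s <= t - s.
Proof.
move=> r0 st; case: (clampP r s r0) => -[? ->]; case: (clampP r t r0) => -[? ->];
  apply/andP; split; lra.
Qed.

Lemma clamp_lipschitz r s t :
  0 <= r -> (clamp r s - clamp r t) ^+ 2 <= (s - t) ^+ 2.
Proof.
move=> r0; have [st|/ltW ts] := lerP s t.
  have := clamp_increment r s t r0 st; nra.
have := clamp_increment r t s r0 ts; nra.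
Qed.

Lemma huber_remainder r t h : 0 <= r ->
  `|huber r (t + h) - huber r t - clamp r t * h| <= h ^+ 2.
Proof.
move=> r0; rewrite ler_norml /huber; apply/andP; split.
  case: (clampP r t r0) => -[? ->]; case: (clampP r (t + h) r0) => -[? ->]; nra.
case: (clampP r t r0) => -[? ->]; case: (clampP r (t + h) r0) => -[? ->]; nra.
Qed.

Lemma huber0 r : 0 <= r -> huber r 0 = 0.
Proof. by move=> r0; rewrite /huber clamp0// mul0r expr0n/= mul0r subr0. Qed.

Lemma huber_ge0 r t : 0 <= r -> 0 <= huber r t.
Proof. by rewrite /huber => r0; case: (clampP r t r0) => -[? ->]; nra. Qed.

Lemma huber_ge r t : 0 <= r -> r <= t -> huber r t = t * r - r ^+ 2 / 2.
Proof.
rewrite /huber => r0 rt; case: (clampP r t r0) => -[? ->]; last by [].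
  have -> : r = 0 by lra.
  by rewrite oppr0.
by have -> : t = r by lra.
Qed.

End Clamp.

(** * Hard instances: slow travel down a Huber slope, and outward spirals *)

Lemma slow_instance {R : realType} (ell mu Delta eta_x eta_y eps : R) :
  0 < mu -> mu <= ell -> 0 < eta_x -> 0 < eps -> 2 * eps ^+ 2 <= Delta * ell ->
  hard_instance ell mu Delta eta_x eta_y eps (Delta / (4 * eta_x * eps ^+ 2)).
Proof.
move=> mu0 muell etax0 eps0 epsD.
have ell0 : 0 < ell by lra.
(* The plateau slope [ell * r] is twice the tolerance. *)
pose r := 2 * eps / ell.
have r0 : 0 <= r by rewrite divr_ge0 ?mulr_ge0 ?ltW.
pose p t := ell * huber r t; pose dp t := ell * clamp r t.
(* Solves [p X = Delta] on the linear branch of [p]. *)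
pose X := Delta / (2 * eps) + eps / ell.
have pP x h : `|p (x + h) - p x - dp x * h| <= ell * h ^+ 2.
  rewrite /p /dp -mulrBr -mulrA -mulrBr normrM gtr0_norm//.
  by apply: ler_wpM2l; [exact: ltW | exact: huber_remainder].
exists 1%N, 1%N, (sep_f 1 p 0 mu), (sep_Phi 1 p 0 mu), (const_mx X), 0.
split; first split => //.
- apply: (sep_smooth _ _ dp ell) => // x1 x2 y1 y2.
  rewrite /dp -mulrBr !mul0r addr0 sub0r sqrrN !exprMn.
  apply: lerD; first by rewrite ler_wpM2l ?sqr_ge0// clamp_lipschitz.
  by rewrite ler_wpM2r ?sqr_ge0// ler_pXn2r// nnegrE ltW.
- exact: sep_strongly_concave.
- exact: (sep_is_max _ _ _ _ mu0).
split.
  exists 0; split.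
    apply: (sep_is_min _ _ _ _ ) => //.
      by rewrite /p huber0// mulr0.
    by move=> t; rewrite expr0n/= mul0r mul0r addr0; apply: mulr_ge0;
      [exact: ltW | exact: huber_ge0].
  rewrite subr0 /sep_Phi big_ord1 mxE expr0n/= mul0r mul0r addr0 /p huber_ge//.
    by rewrite /X /r; field; rewrite !gt_eqF.
  (* After one [eps / ell] is cancelled, [r <= X] is exactly the assumption on [eps]. *)
  have -> : r = eps / ell + eps / ell by rewrite /r; field; rewrite gt_eqF.
  rewrite lerD2r ler_pdivrMr// mulrAC ler_pdivlMr ?mulr_gt0//.
  by rewrite mulrC -mulrA.
move=> t.
pose z := gda (sep_f 1 p 0 mu) eta_x eta_y (const_mx X) 0.
have zX s : X - s%:R * (2 * eps * eta_x) <= (z s).1 0 0.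
  elim: s => [|s IH]; first by rewrite /z /gda /= mxE mul0r subr0.
  have [/(_ 0) -> _] :=
    gda_sepS 1 p dp ell 0 mu pP mu0 eta_x eta_y (const_mx X) 0 s.
  rewrite -/(z s) mul0r addr0 -natr1 mulrDl mul1r opprD addrA lerD// lerN2.
  rewrite mulrC; apply: ler_wpM2r; first exact: ltW.
  rewrite /dp mulrC -ler_pdivlMr//.
  exact: clamp_le.
rewrite -/(z t) (grad_sep_Phi _ _ _ _ _ _ pP)// => gle.
have dple : dp ((z t).1 0 0) <= eps.
  apply: le_trans gle; rewrite /enorm big_ord1 mxE expr0n/= !mul0r addr0.
  by rewrite sqrtr_sqr ler_norm.
have zle : (z t).1 0 0 <= eps / ell.
  have cle : clamp r ((z t).1 0 0) <= eps / ell.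
    by rewrite ler_pdivlMr// mulrC.
  apply: (le_trans _ cle); apply: clamp_lt => //.
  apply: (le_lt_trans cle); rewrite /r -mulrA ltr_pMl ?divr_gt0//; lra.
(* The offset [eps / ell] in [X] cancels, leaving the distance [Delta / (2 * eps)] to travel. *)
have := le_trans (zX t) zle.
rewrite /X lerBlDl lerD2r => h.
rewrite ler_pdivrMr ?mulr_gt0 ?exprn_gt0//.
move: h; rewrite ler_pdivrMr ?mulr_gt0//.
congr (_ <= _); ring.
Qed.

(* With x_1 + i x_2 and y_1 + i y_2 as single complex variables, (1, p + i q) is an
   eigenvector of the GDA map for the eigenvalue u + i v. *)
Lemma spiral_instance {R : realType}
    (ell mu Delta eta_x eta_y a b u v p q eps B : R) :
  0 < mu -> 0 < Delta -> 0 <= a -> 0 < a + b ^+ 2 / mu ->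
  (forall s t : R, (a * s + b * t) ^+ 2 + (b * s - mu * t) ^+ 2
                   <= ell ^+ 2 * s ^+ 2 + ell ^+ 2 * t ^+ 2) ->
  u = 1 - eta_x * a - eta_x * b * p -> v = - (eta_x * b * q) ->
  eta_y * b + (1 - eta_y * mu) * p = u * p - v * q ->
  (1 - eta_y * mu) * q = u * q + v * p ->
  1 <= u ^+ 2 + v ^+ 2 ->
  eps < (a + b ^+ 2 / mu) * Num.sqrt (2 * Delta / (a + b ^+ 2 / mu)) ->
  hard_instance ell mu Delta eta_x eta_y eps B.
Proof.
move=> mu0 D0 a0; set k := a + b ^+ 2 / mu => k0 lip Hu Hv Hy1 Hy2 uv1 epsk.
(* Here Phi is [k/2] times the squared norm, so starting at norm [X] gives the gap [Delta]. *)
set X := Num.sqrt (2 * Delta / k) in epsk.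
have X2 : X ^+ 2 = 2 * Delta / k.
  by rewrite sqr_sqrtr// divr_ge0 ?mulr_ge0// ltW.
pose P (t : R) := a / 2 * t ^+ 2; pose dP (t : R) := a * t.
have PP x h : `|P (x + h) - P x - dP x * h| <= a / 2 * h ^+ 2.
  have -> : P (x + h) - P x - dP x * h = a / 2 * h ^+ 2 by rewrite /P /dP; field.
  by rewrite ger0_norm// mulr_ge0 ?sqr_ge0// divr_ge0.
pose x0 : 'rV[R]_2 := \row_i (if i == 0 then X else 0).
pose y0 : 'rV[R]_2 := \row_i (if i == 0 then p * X else q * X).
exists 2%N, 2%N, (sep_f 2 P b mu), (sep_Phi 2 P b mu), x0, y0.
split; first split => //.
- apply: (sep_smooth _ _ dP (a / 2)) => // x1 x2 y1 y2.
  by rewrite /dP -mulrBr.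
- exact: sep_strongly_concave.
- exact: (sep_is_max _ _ _ _ mu0).
split.
  exists 0; split.
    apply: (sep_is_min _ _ _ _ ) => //.
      by rewrite /P expr0n/= mulr0.
    move=> t; rewrite /P -mulrDl mulr_ge0 ?sqr_ge0//.
    have -> : a / 2 + b ^+ 2 / (2 * mu) = k / 2.
      by rewrite /k; field; rewrite gt_eqF.
    by rewrite divr_ge0// ltW.
  rewrite subr0 /sep_Phi !big_ord_recl big_ord0 !mxE/= /P expr0n/= !mulr0 !addr0.
  rewrite -mulrDl X2.
  have -> : a / 2 + b ^+ 2 / (2 * mu) = k / 2.
    by rewrite /k; field; rewrite gt_eqF.
  by field; rewrite gt_eqF.
move=> t.
pose z := gda (sep_f 2 P b mu) eta_x eta_y x0 y0.
pose x s i := (z s).1 0 i; pose y s i := (z s).2 0 i.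
(* In complex terms: [y = (p + iq) x] persists, and each step multiplies [x] by [u + iv], of modulus
   at least 1. *)
have inv s : [/\ X ^+ 2 <= x s 0 ^+ 2 + x s 1 ^+ 2,
    y s 0 = p * x s 0 - q * x s 1 & y s 1 = q * x s 0 + p * x s 1].
  elim: s => [|s [IH1 IH2 IH3]].
    rewrite /x /y /z /gda /= !mxE/= expr0n/= !mulr0 subr0 !addr0; by split.
  have [xS0 yS0] := gda_sepS 2 P dP (a / 2) b mu PP mu0 eta_x eta_y x0 y0 s.
  have xS i : x s.+1 i = x s i - eta_x * (a * x s i + b * y s i) by exact: xS0.
  have yS i : y s.+1 i = y s i + eta_y * (b * x s i - mu * y s i) by exact: yS0.
  have x0S : x s.+1 0 = u * x s 0 - v * x s 1.
    rewrite xS IH2 Hu Hv; ring.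
  have x1S : x s.+1 1 = v * x s 0 + u * x s 1.
    rewrite xS IH3 Hu Hv; ring.
  have y0S : y s.+1 0 = (u * p - v * q) * x s 0 - (u * q + v * p) * x s 1.
    rewrite -Hy1 -Hy2 yS IH2; ring.
  have y1S : y s.+1 1 = (u * q + v * p) * x s 0 + (u * p - v * q) * x s 1.
    rewrite -Hy1 -Hy2 yS IH3; ring.
  rewrite x0S x1S y0S y1S; split; [|ring|ring].
  have -> : (u * x s 0 - v * x s 1) ^+ 2 + (v * x s 0 + u * x s 1) ^+ 2
          = (u ^+ 2 + v ^+ 2) * (x s 0 ^+ 2 + x s 1 ^+ 2) by ring.
  by apply: (le_trans IH1); rewrite ler_peMl// addr_ge0 ?sqr_ge0.
(* The gradient is [k] times the iterate, of norm at least [k * X > eps], so the premise is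
   contradictory. *)
rewrite -/(z t) (grad_sep_Phi _ _ _ _ _ _ PP)// => gle; exfalso.
have [Xle _ _] := inv t.
have kX : 0 <= k * X by rewrite mulr_ge0 ?sqrtr_ge0 ?ltW.
suff : k * X <= eps by rewrite leNgt epsk.
apply: le_trans gle; rewrite -(ger0_norm kX) -sqrtr_sqr /enorm ler_wsqrtr//.
rewrite !big_ord_recl big_ord0 !mxE addr0.
rewrite (_ : lift _ _ = 1); last exact: val_inj.
rewrite -/(x t 0) -/(x t 1) /dP -!mulrDl -/k !exprMn -mulrDr.
by rewrite ler_wpM2l ?sqr_ge0.
Qed.

(** [u + iv] is a root of [z^2 - tau z + 1]. The roots have product 1: a conjugate pair on the unit
    circle if [|tau| <= 2], otherwise real, and the more negative one is taken. *)
Lemma expanding_root {R : rcfType} (tau : R) : tau <= 2 ->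
  exists u v, [/\ u ^+ 2 - v ^+ 2 = tau * u - 1, 2 * u * v = tau * v
                & 1 <= u ^+ 2 + v ^+ 2].
Proof.
move=> tau2; have [taum2|taum2] := lerP (- 2) tau.
  have h : 0 <= 1 - tau ^+ 2 / 4 by nra.
  exists (tau / 2), (Num.sqrt (1 - tau ^+ 2 / 4)); rewrite sqr_sqrtr//.
  by split; [field | field | lra].
have h : 0 <= tau ^+ 2 - 4 by nra.
have := sqr_sqrtr h; have := sqrtr_ge0 (tau ^+ 2 - 4).
set s := Num.sqrt _ => s0 s2.
exists ((tau - s) / 2), 0; split; last by nra.
  have -> : ((tau - s) / 2) ^+ 2 - 0 ^+ 2 = (tau ^+ 2 - 2 * tau * s + s ^+ 2) / 4.
    by field.
  by rewrite s2; field.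
by rewrite !mulr0.
Qed.

(** * Case split on the primal learning rate *)

Theorem theorem5p1 (R : realType) (ell Delta : R)
    (hell : 0 < ell) (hDelta : 0 < Delta) :
  exists c : R, 0 < c /\
    forall mu : R, 0 < mu -> mu <= ell ->
    forall eta_x eta_y : R, 0 < eta_x -> 0 < eta_y ->
    exists eps0 : R, 0 < eps0 /\
    forall eps : R, 0 < eps -> eps < eps0 ->
    exists (m n : nat) (f : 'rV[R]_m -> 'rV[R]_n -> R) (Phi : 'rV[R]_m -> R)
           (x0 : 'rV[R]_m) (y0 : 'rV[R]_n),
      [/\ (0 < m)%N, (0 < n)%N, smooth ell f,
          (forall x : 'rV[R]_m, strongly_concave mu (f x)) & is_max_y f Phi] /\
      (exists Phi_min : R, is_min Phi Phi_min /\ Phi x0 - Phi_min = Delta) /\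
      (forall T t : nat, (1 <= t)%N -> (t <= T)%N ->
         enorm (grad Phi (gda f eta_x eta_y x0 y0 t).1) <= eps ->
         c * ((ell / mu) / eps ^+ 2) <= T%:R).
Proof.
exists (Delta * ell / 16); split; first by rewrite divr_gt0 ?mulr_gt0.
move=> mu mu0 muell eta_x eta_y etax0 etay0.
have ell2 : 0 < ell ^+ 2 by rewrite exprn_gt0.
suff [eps0 [e0 hard]] : exists eps0 : R, 0 < eps0 /\ forall eps : R,
    0 < eps -> eps < eps0 -> hard_instance ell mu Delta eta_x eta_y eps
      (Delta * ell / 16 * ((ell / mu) / eps ^+ 2)).
  exists eps0; split=> // eps epsgt0 epslt.
  have [m [n [f [Phi [x0 [y0 [h1 [h2 h3]]]]]]]] := hard eps epsgt0 epslt.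
  exists m, n, f, Phi, x0, y0; split=> //; split=> // T t _ tT gle.
  by apply: (le_trans (h3 t gle)); rewrite ler_nat.
have [etax_small|etax_big] := ltrP (eta_x * ell ^+ 2) (4 * mu).
  (* [eps < 1] gives [eps^2 < eps], so the second bound yields [2 * eps^2 <= Delta * ell]. *)
  exists (Num.min 1 (Delta * ell / 2)).
  split; first by rewrite lt_min ltr01 divr_gt0 ?mulr_gt0.
  move=> eps eps0; rewrite lt_min => /andP[eps1 epsD].
  have epsD' : 2 * eps ^+ 2 <= Delta * ell by nra.
  have [m [n [f [Phi [x0 [y0 [h1 [h2 h3]]]]]]]] :=
    slow_instance ell mu Delta eta_x eta_y eps mu0 muell etax0 eps0 epsD'.
  exists m, n, f, Phi, x0, y0; split=> //; split=> // t /h3; apply: le_trans.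
  rewrite ler_pdivlMr ?mulr_gt0 ?exprn_gt0//.
  have -> : Delta * ell / 16 * (ell / mu / eps ^+ 2) * (4 * eta_x * eps ^+ 2)
          = Delta * (eta_x * ell ^+ 2 / (4 * mu)).
    by field; rewrite !gt_eqF.
  by rewrite ler_piMr ?ltW// ltr_pdivrMr ?mulr_gt0// mul1r.
have [etax_big'|etax_lt] := lerP 2 (eta_x * ell).
  exists ((ell + 0 ^+ 2 / mu) * Num.sqrt (2 * Delta / (ell + 0 ^+ 2 / mu))).
  rewrite expr0n/= mul0r addr0; split.
    by rewrite mulr_gt0// sqrtr_gt0 divr_gt0 ?mulr_gt0.
  move=> eps _ epslt.
  (* The dual variable stays 0 and [x] is multiplied by [1 - eta_x * ell <= -1]. *)
  apply: (spiral_instance _ _ _ _ _ ell 0 (1 - eta_x * ell) 0 0 0) => //.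
  - exact: ltW.
  - by rewrite expr0n/= mul0r addr0.
  - move=> s t; rewrite !mul0r addr0 sub0r sqrrN !exprMn lerD2l.
    by rewrite ler_wpM2r ?sqr_ge0// ler_pXn2r// nnegrE ltW.
  - by rewrite !mulr0 subr0.
  - by rewrite !mulr0 oppr0.
  - by rewrite !mulr0 subr0 addr0.
  - by rewrite !mulr0 addr0.
  - by rewrite expr0n/= addr0; nra.
  - by rewrite expr0n/= mul0r addr0.
have b2 : Num.sqrt (mu / eta_x) ^+ 2 = mu / eta_x.
  by rewrite sqr_sqrtr// divr_ge0// ltW.
have b0 : 0 < Num.sqrt (mu / eta_x) by rewrite sqrtr_gt0 divr_gt0.
move: b2 b0; set b := Num.sqrt _ => b2 b0.
have k0 : 0 < 0 + b ^+ 2 / mu by rewrite add0r divr_gt0// exprn_gt0.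
exists ((0 + b ^+ 2 / mu) * Num.sqrt (2 * Delta / (0 + b ^+ 2 / mu))); split.
  by rewrite mulr_gt0// sqrtr_gt0 divr_gt0 ?mulr_gt0.
move=> eps _ epslt.
have etaxb2 : eta_x * b ^+ 2 = mu by rewrite b2 mulrCA divff ?mulr1// gt_eqF.
have mu2 : 2 * mu <= ell by nra.
have b2ell : 4 * b ^+ 2 <= ell ^+ 2.
  by rewrite -(ler_pM2l etax0) mulrCA etaxb2.
(* [2 - eta_y * mu] is the trace of the GDA map, whose determinant is 1 by [etaxb2]. *)
have tau2 : 2 - eta_y * mu <= 2 by rewrite gerBl mulr_ge0 ?ltW.
have [u [v [Huv1 Huv2 uv1]]] := expanding_root _ tau2.
have etaxb : eta_x * b != 0 by rewrite mulf_neq0 ?gt_eqF.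
(* The first row of the eigenvector equation, [u + iv = 1 - eta_x b (p + iq)], determines [p] and
   [q]. *)
apply: (spiral_instance _ _ _ _ _ 0 b u v
  ((1 - u) / (eta_x * b)) (- v / (eta_x * b))) => //.
- move=> s t.
  have : 4 * mu ^+ 2 <= ell ^+ 2 by nra.
  (* The last square gives [(bs - mu t)^2 <= 2 b^2 s^2 + 2 mu^2 t^2]; [b] and [mu] are at most
     [ell/2]. *)
  have := sqr_ge0 s; have := sqr_ge0 t; have := sqr_ge0 (b * s + mu * t); nra.
- by rewrite mulr0 subr0 mulrCA divff// mulr1 opprB addrC subrK.
- by rewrite mulrCA divff// mulr1 opprK.
(* With denominators cleared, the second row becomes the real part of the characteristic equation
   here and its imaginary part in the next goal. *)
- apply: (mulfI etaxb).
  have -> : eta_x * b * (eta_y * b + (1 - eta_y * mu) * ((1 - u) / (eta_x * b)))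
     = eta_y * (eta_x * b ^+ 2) + (1 - eta_y * mu) * (1 - u).
    by field; rewrite !gt_eqF.
  have -> : eta_x * b * (u * ((1 - u) / (eta_x * b)) - v * (- v / (eta_x * b)))
     = u - (u ^+ 2 - v ^+ 2) by field; rewrite !gt_eqF.
  by rewrite Huv1 etaxb2; ring.
- apply: (mulfI etaxb).
  have -> : eta_x * b * ((1 - eta_y * mu) * (- v / (eta_x * b)))
     = v - (2 - eta_y * mu) * v by field; rewrite !gt_eqF.
  by rewrite -Huv2; field; rewrite !gt_eqF.
Qed.
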